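(* Let $R$ be a left Zacharias domain which is a (commutative) principal ideal domain, let $\mathsf R$ be a multivariate Ore extension of $R$ in which each $\alpha_i$ is an automorphism of $R$, and let $F=\{g_1,\dots,g_u\}\subset\mathsf R^m\setminus\{0\}$, $\mathbf M(g_i)=c_i\tau_i\mathbf e_{l_i}$. The following hold. (1) For all $i,j,k\in\{1,\dots,u\}$ with $\mathbf e_{l_i}=\mathbf e_{l_j}=\mathbf e_{l_k}$, $$\frac{\mu(i,j,k)}{\mu(i,k)}\ast b(i,k)-\frac{\mu(i,j,k)}{\mu(i,j)}\ast b(i,j)+\frac{\mu(i,j,k)}{\mu(k,j)}\ast b(k,j)=0.$$ (2) $\{\{i,j\}:1\le i<j\le u,\ \mathbf e_{l_i}=\mathbf e_{l_j},\ b(i,j)\text{ not redundant}\}$ is a useful S-pair set for $F$. (3) Let $G=\{g_1,\dots,g_s\}$, $s\le u$, and let $\mathfrak{GM}_*\subset\{\{i,j\}:1\le i<j<s,\ \mathbf e_{l_i}=\mathbf e_{l_j}\}$ be a useful S-pair set for $\{g_1,\dots,g_{s-1}\}$. Let $\overline M=\{\mu(j,s):1\le j<s,\ \mathbf e_{l_j}=\mathbf e_{l_s}\}$ and let $\overline M'\subset\overline M$ be the set of those $\mu(j,s)\in\overline M$ for which there is $\mu(j',s)\in\overline M$ with $\mu(j',s)\mid\mu(j,s)\ne\mu(j',s)$. For each $\mu\in\overline M\setminus\overline M'$ choose $i_\mu$, $1\le i_\mu<s$, $\mathbf e_{l_{i_\mu}}=\mathbf e_{l_s}$, with $\mu=\mu(i_\mu,s)$.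 Then $\mathfrak{GM}_*\cup\{\{i_\mu,s\}:\mu\in\overline M\setminus\overline M'\}$ is a useful S-pair set for $G$.
   Context: **Ore extensions.** A multivariate Ore extension $\mathsf R=R[Y_1;\alpha_1,\delta_1]\cdots[Y_n;\alpha_n,\delta_n]$ of a domain $R$ is an iterated Ore extension ($Y_i\star r=\alpha_i(r)Y_i+\delta_i(r)$, $\alpha_i$ an injective ring endomorphism mapping $R$ to $R$, $\delta_i$ an $\alpha_i$-derivation mapping $R$ to $R$) such that $\alpha_j\delta_i=\delta_i\alpha_j$ for $i\ne j$, $\alpha_i\alpha_j=\alpha_j\alpha_i$, $\delta_i\delta_j=\delta_j\delta_i$, and $\alpha_j(Y_i)=Y_i$, $\delta_j(Y_i)=0$ for $i<j$. It is a free left $R$-module on the set of terms $\mathcal T=\{Y_1^{a_1}\cdots Y_n^{a_n}\}$, a commutative monoid. For $\tau=Y_1^{a_1}\cdots Y_n^{a_n}$ put $\alpha_\tau=\alpha_1^{a_1}\cdots\alpha_n^{a_n}:R\to R$. The associated graded Ore extension $\mathsf S$ is the same left $R$-module with multiplication $\ast$ determined by $(a\tau)\ast(b\omega)=a\,\alpha_\tau(b)\,\tau\omega$. $\mathsf R^m$ has canonical basis $\mathbf e_1,\dots,\mathbf e_m$ and terms $\mathcal T^{(m)}=\{t\mathbf e_i\}$; a term ordering on $\mathcal T^{(m)}$ compatible with one on $\mathcal T$ is fixed and $\mathbf M(f)$ denotes the maximal monomial (leading coefficient times maximal term) of $f\neq0$. **Monomials.** Monomials are $c\tau$, $c\in R\setminus\{0\}$,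 $\tau\in\mathcal T$. $\mu\mid\mu'$ means $\mu'=q\ast\mu$ for a monomial $q$, which is then unique and denoted $\mu'/\mu$. Least common multiples in $R$ are determined up to units, and (in)equalities between monomials $\mu(\cdot)$ in the definition of redundancy and in (3) are understood up to a unit factor of the coefficient. For $i,j,k$ with $\mathbf e_{l_i}=\mathbf e_{l_j}=\mathbf e_{l_k}$ put $\mu(i)=c_i\tau_i$; $\tau(i,j)=\mathrm{lcm}(\tau_i,\tau_j)$, $c(i,j)=c(j,i)=\mathrm{lcm}\big(\alpha_{\tau(i,j)/\tau_i}(c_i),\alpha_{\tau(i,j)/\tau_j}(c_j)\big)$, $\mu(i,j)=c(i,j)\tau(i,j)$; $\tau(i,j,k)=\mathrm{lcm}(\tau_i,\tau_j,\tau_k)$, $c(i,j,k)=\mathrm{lcm}\big(\alpha_{\tau(i,j,k)/\tau(i,j)}(c(i,j)),\alpha_{\tau(i,j,k)/\tau(i,k)}(c(i,k)),\alpha_{\tau(i,j,k)/\tau(j,k)}(c(j,k))\big)$, $\mu(i,j,k)=c(i,j,k)\tau(i,j,k)$. With $e_1,\dots,e_u$ the canonical basis of $\mathsf S^u$, $b(i,j)=\frac{\mu(i,j)}{\mu(j)}e_j-\frac{\mu(i,j)}{\mu(i)}e_i$. **Useful sets and redundancy.** Let $\mathfrak s_L:\mathsf S^u\to\mathsf S^m$, $\sum h_ie_i\mapsto\sum h_i\ast\mathbf M(g_i)$. A left Gebauer–Möller set for $F$ is a set of generators of the left $\mathsf S$-module $\ker(\mathfrak s_L)$, each homogeneous (of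 the form $\sum a_i\lambda_ie_i$, $a_i\in R,\lambda_i\in\mathcal T$, with $\lambda_i\tau_i\mathbf e_{l_i}$ the same for all $i$ with $a_i\ne0$). A useful S-pair set for $F$ is a set $\mathfrak{GM}\subset\{\{i,j\}:1\le i<j\le u,\mathbf e_{l_i}=\mathbf e_{l_j}\}$ such that $\{b(i,j):\{i,j\}\in\mathfrak{GM},\ i<j\}$ is a left Gebauer–Möller set for $F$ (and analogously for $G$ and $\{g_1,\dots,g_{s-1}\}$). For $i<j$ with $\mathbf e_{l_i}=\mathbf e_{l_j}$, $b(i,j)$ is redundant if either (a) there is $k>j$, $\mathbf e_{l_k}=\mathbf e_{l_i}=\mathbf e_{l_j}$, with $\mu(i,j,k)=\mu(i,j)$ and $\mu(i,k)\ne\mu(i,j)\ne\mu(j,k)$; or (b) there is $k<j$, $\mathbf e_{l_k}=\mathbf e_{l_i}=\mathbf e_{l_j}$, with $\mu(j,k)\mid\mu(i,j)\ne\mu(j,k)$. **Zacharias ring.** A ring $R$ with identity is a left Zacharias ring if it is noetherian, there is an algorithm deciding membership of $c\in R^m$ in the left module generated by a finite $\{c_1,\dots,c_t\}\subset R^m\setminus\{0\}$ and producing $d_i$ with $c=\sum d_ic_i$ when it holds, and there is an algorithm computing a finite generating set of the left syzygy module of $c_1,\dots,c_t$. *)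

(* Defs.v *)
From HB Require Import structures.
From mathcomp Require Import all_boot all_order all_algebra.
From mathcomp Require Import mpoly.
From Stdlib Require Import ClassicalEpsilon.

Set Implicit Arguments.
Unset Strict Implicit.
Unset Printing Implicit Defensive.

Import GRing.Theory.
Local Open Scope ring_scope.

(** * Ring-theoretic notions *)

Definition left_ideal (R : nzRingType) (I : R -> Prop) : Prop :=
  [/\ I 0, forall x y, I x -> I y -> I (x + y) & forall a x, I x -> I (a * x)].

Definition left_noetherian (R : nzRingType) : Prop :=
  forall I : R -> Prop, left_ideal I ->
    exists (k : nat) (g : 'I_k -> R),
      forall x, I x <-> exists q : 'I_k -> R, x = \sum_(i < k) q i * g i.

Definition principal_ideal_domain (R : idomainType) : Prop :=
  forall I : R -> Prop, left_ideal I ->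
    exists d, forall x, I x <-> exists q, x = q * d.

(* The vectors c_1, ..., c_t of R^m are the rows of C, so that d *m C is the
   left linear combination of the c_i with coefficients d_i.  The record lives
   in Type: its last two fields are the algorithms themselves. *)
Record left_zacharias (R : nzRingType) : Type := LeftZacharias {
  lz_noetherian : left_noetherian R;
  lz_membership : forall (m t : nat) (C : 'M[R]_(t, m)) (c : 'rV[R]_m),
    (forall i, row i C != 0) ->
    {d : 'rV[R]_t | c = d *m C} + {~ exists d : 'rV[R]_t, c = d *m C};
  lz_syzygies : forall (m t : nat) (C : 'M[R]_(t, m)),
    (forall i, row i C != 0) ->
    {k : nat & {Z : 'M[R]_(k, t) |
       forall d : 'rV[R]_t, d *m C = 0 <-> exists e : 'rV[R]_k, d = e *m Z}}
}.

(** * Multivariate Ore extensions *)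

Definition subring_pred (S : nzRingType) (P : S -> Prop) : Prop :=
  [/\ P 1, forall x y, P x -> P y -> P (x - y)
    & forall x y, P x -> P y -> P (x * y)].

(* The subring R[Y_0, ..., Y_(k-1)] of S generated by the image of R and the
   first k variables. *)
Definition ore_stage (R S : nzRingType) (n : nat) (inj : R -> S)
    (Y : 'I_n -> S) (k : nat) (x : S) : Prop :=
  forall P : S -> Prop, subring_pred P -> (forall r, P (inj r)) ->
    (forall i : 'I_n, (i < k)%N -> P (Y i)) -> P x.

(* [is_ore_extension A B alpha delta Y]: inside S, the subring B is the Ore
   extension A[Y; alpha, delta] of the subring A.  The maps alpha and delta are
   only meaningful on A; outside of A their values are irrelevant.  Recall that
   p.[Y] = \sum_k p`_k * Y ^+ k, with coefficients on the left. *)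
Record is_ore_extension (S : nzRingType) (A B : S -> Prop)
    (alpha delta : S -> S) (Y : S) : Prop := IsOreExtension {
  ore_alpha_stable : forall x, A x -> A (alpha x);
  ore_alpha1 : alpha 1 = 1;
  ore_alphaD : forall x y, A x -> A y -> alpha (x + y) = alpha x + alpha y;
  ore_alphaM : forall x y, A x -> A y -> alpha (x * y) = alpha x * alpha y;
  ore_alpha_inj : forall x y, A x -> A y -> alpha x = alpha y -> x = y;
  ore_delta_stable : forall x, A x -> A (delta x);
  ore_deltaD : forall x y, A x -> A y -> delta (x + y) = delta x + delta y;
  ore_deltaM : forall x y, A x -> A y ->
    delta (x * y) = alpha x * delta y + delta x * y;
  ore_commutation : forall x, A x -> Y * x = alpha x * Y + delta x;
  ore_span : forall f,
    B f <-> exists2 p : {poly S}, (forall k, A p`_k) & f = p.[Y];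
  ore_free : forall p q : {poly S}, (forall k, A p`_k) -> (forall k, A q`_k) ->
    p.[Y] = q.[Y] -> p = q
}.

(* alpha_i and delta_i are maps on R[Y_0, ..., Y_(i-1)]; their restrictions to
   R are recorded separately as [ore_alphaR i] and [ore_deltaR i].  The
   commutation relations between the i-th and j-th maps are required on the
   subring where both are defined. *)
Record mvOre (R : nzRingType) (n : nat) : Type := MvOre {
  ore_ring :> nzRingType;
  ore_inj : {rmorphism R -> ore_ring};
  ore_var : 'I_n -> ore_ring;
  ore_alpha : 'I_n -> ore_ring -> ore_ring;
  ore_delta : 'I_n -> ore_ring -> ore_ring;
  ore_alphaR : 'I_n -> {rmorphism R -> R};
  ore_deltaR : 'I_n -> R -> R;
  ore_inj_inj : injective ore_inj;
  ore_iterated : forall i : 'I_n,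
    is_ore_extension (ore_stage ore_inj ore_var i)
      (ore_stage ore_inj ore_var i.+1)
      (ore_alpha i) (ore_delta i) (ore_var i);
  ore_top : forall x, ore_stage ore_inj ore_var n x;
  ore_alpha_base : forall i r, ore_alpha i (ore_inj r) = ore_inj (ore_alphaR i r);
  ore_delta_base : forall i r, ore_delta i (ore_inj r) = ore_inj (ore_deltaR i r);
  ore_alpha_delta : forall (i j : 'I_n) x, i != j ->
    ore_stage ore_inj ore_var (minn i j) x ->
    ore_alpha j (ore_delta i x) = ore_delta i (ore_alpha j x);
  ore_alpha_alpha : forall (i j : 'I_n) x, ore_stage ore_inj ore_var (minn i j) x ->
    ore_alpha i (ore_alpha j x) = ore_alpha j (ore_alpha i x);
  ore_delta_delta : forall (i j : 'I_n) x, ore_stage ore_inj ore_var (minn i j) x ->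
    ore_delta i (ore_delta j x) = ore_delta j (ore_delta i x);
  ore_alpha_var : forall i j : 'I_n, (i < j)%N ->
    ore_alpha j (ore_var i) = ore_var i;
  ore_delta_var : forall i j : 'I_n, (i < j)%N ->
    ore_delta j (ore_var i) = 0
}.

Lemma ore_alphaR_comm (R : nzRingType) (n : nat) (O : mvOre R n)
    (i j : 'I_n) (r : R) :
  ore_alphaR O i (ore_alphaR O j r) = ore_alphaR O j (ore_alphaR O i r).
Proof.
apply: (@ore_inj_inj R n O); rewrite -!ore_alpha_base.
by apply: ore_alpha_alpha => P _ HP _; apply: HP.
Qed.

(* alpha_tau = alpha_0^(tau 0) o ... o alpha_(n-1)^(tau (n-1)) on R *)
Definition alpha_term (R : nzRingType) (n : nat) (O : mvOre R n)
    (t : 'X_{1..n}) : R -> R :=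
  foldr (fun i f => iter (t i) (ore_alphaR O i) \o f) id (enum 'I_n).

Section AlphaTerm.
Variables (R : nzRingType) (n : nat) (O : mvOre R n).
Implicit Types (t s : 'X_{1..n}) (a b : R) (e : seq 'I_n).

Let aL t e := foldr (fun i f => iter (t i) (ore_alphaR O i) \o f) id e.

Let iter_comm1 i j k a : ore_alphaR O i (iter k (ore_alphaR O j) a)
  = iter k (ore_alphaR O j) (ore_alphaR O i a).
Proof. by elim: k => //= k IH; rewrite ore_alphaR_comm IH. Qed.

Let iter_comm i j k l a :
  iter k (ore_alphaR O i) (iter l (ore_alphaR O j) a)
  = iter l (ore_alphaR O j) (iter k (ore_alphaR O i) a).
Proof. by elim: k a => //= k IH a; rewrite IH iter_comm1. Qed.

Let aL_comm i k t e a : aL t e (iter k (ore_alphaR O i) a)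
  = iter k (ore_alphaR O i) (aL t e a).
Proof. by elim: e => //= j e ->; rewrite iter_comm. Qed.

Lemma alpha_termD t s a :
  alpha_term O (t + s)%MM a = alpha_term O t (alpha_term O s a).
Proof.
rewrite /alpha_term -!/(aL _ _).
elim: (enum _) => //= i e ->.
by rewrite mnmDE iterD aL_comm.
Qed.

Lemma alpha_term0 a : alpha_term O 0%MM a = a.
Proof.
by rewrite /alpha_term; elim: (enum _) => //= i e ->; rewrite mnm0E.
Qed.

Lemma alpha_term_is_zmod_morphism t : zmod_morphism (alpha_term O t).
Proof.
move=> a b; rewrite /alpha_term; elim: (enum _) => //= i e ->.
by elim: (t i) => //= k ->; rewrite rmorphB.
Qed.

Lemma alpha_term_is_monoid_morphism t : monoid_morphism (alpha_term O t).
Proof.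
split=> [|a b]; rewrite /alpha_term; elim: (enum _) => //= i e ->.
  by elim: (t i) => //= k ->; rewrite rmorph1.
by elim: (t i) => //= k ->; rewrite rmorphM.
Qed.

HB.instance Definition _ t := GRing.isZmodMorphism.Build R R (alpha_term O t)
  (alpha_term_is_zmod_morphism t).
HB.instance Definition _ t := GRing.isMonoidMorphism.Build R R (alpha_term O t)
  (alpha_term_is_monoid_morphism t).

End AlphaTerm.

(** * The associated graded Ore extension *)

(* The free left R-module on the terms, as the left R-module underlying
   {mpoly R[n]}; only the module structure of {mpoly R[n]} is used, and the
   ring structure put on it below is the twisted one. *)
Definition graded (R : nzRingType) (n : nat) (O : mvOre R n) : Type :=
  {mpoly R[n]}.

HB.instance Definition _ (R : nzRingType) (n : nat) (O : mvOre R n) :=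
  GRing.Lmodule.copy (graded O) {mpoly R[n]}.

Definition graded_mul (R : nzRingType) (n : nat) (O : mvOre R n)
    (p q : graded O) : graded O :=
  \sum_(t <- msupp p) \sum_(s <- msupp q)
     (p@_t * alpha_term O t q@_s) *: 'X_[t + s].

Section GradedRing.
Variables (R : nzRingType) (n : nat) (O : mvOre R n).
Implicit Types (p q r : graded O) (t s : 'X_{1..n}) (a b : R).

Let mon a t : graded O := a *: ('X_[t] : {mpoly R[n]}).

Let sum_ext (V : zmodType) (F : 'X_{1..n} -> R -> V) (p : {mpoly R[n]}) e :
  (forall t, F t 0 = 0) -> uniq e -> {subset msupp p <= e} ->
  \sum_(t <- msupp p) F t p@_t = \sum_(t <- e) F t p@_t.
Proof.
move=> F0 ue sub.
rewrite [RHS](bigID (mem (msupp p))) /= [X in _ + X]big1 ?addr0; last first.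
  by move=> t /memN_msupp_eq0 ->.
rewrite -[RHS]big_filter; apply: perm_big; apply: uniq_perm; rewrite ?filter_uniq //.
move=> t; rewrite mem_filter; case: (boolP (t \in msupp p)) => //= tp.
by rewrite (sub _ tp).
Qed.

Let sum_add (V : zmodType) (F : 'X_{1..n} -> R -> V) (p q : {mpoly R[n]}) :
  (forall t a b, F t (a + b) = F t a + F t b) ->
  \sum_(t <- msupp (p + q)) F t (p + q)@_t
  = \sum_(t <- msupp p) F t p@_t + \sum_(t <- msupp q) F t q@_t.
Proof.
move=> FD; have F0 t : F t 0 = 0.
  by apply: (addIr (F t 0)); rewrite -FD !add0r.
pose e := undup (msupp p ++ msupp q).
have ue : uniq e by apply: undup_uniq.
rewrite !(@sum_ext _ _ _ e) // => [|x|x|x]; rewrite ?mem_undup.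
- by rewrite -big_split /=; apply: eq_bigr => t _; rewrite mcoeffD FD.
- by rewrite mem_cat => ->; rewrite orbT.
- by rewrite mem_cat => ->.
- by move/msuppD_le.
Qed.

Let sum_mon (V : zmodType) (F : 'X_{1..n} -> R -> V) a t :
  (forall t, F t 0 = 0) ->
  \sum_(s <- msupp (mon a t)) F s (mon a t)@_s = F t a.
Proof.
move=> F0; rewrite (@sum_ext _ _ _ [:: t]) //.
  by rewrite big_seq1 mcoeffZ mcoeffX eqxx mulr1.
by move=> s /msuppZ_le; rewrite msuppX.
Qed.

Lemma graded_mulDl : left_distributive (@graded_mul R n O) +%R.
Proof.
move=> p q r; rewrite /graded_mul.
rewrite (sum_add (F := fun t a => \sum_(s <- msupp r)
   (a * alpha_term O t r@_s) *: 'X_[t + s])) // => t a b.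
by rewrite -big_split; apply: eq_bigr => s _; rewrite mulrDl scalerDl.
Qed.

Lemma graded_mulDr : right_distributive (@graded_mul R n O) +%R.
Proof.
move=> p q r; rewrite /graded_mul -big_split /=; apply: eq_bigr => t _.
rewrite (sum_add (F := fun s b => (p@_t * alpha_term O t b) *: 'X_[t + s])) //.
by move=> s a b; rewrite rmorphD mulrDr scalerDl.
Qed.

Lemma graded_mul_mon a t b s :
  graded_mul (a *: 'X_[t] : graded O) (b *: 'X_[s] : graded O)
  = (a * alpha_term O t b) *: 'X_[t + s].
Proof.
rewrite /graded_mul.
rewrite (sum_mon (F := fun t a => \sum_(u <- msupp (mon b s))
   (a * alpha_term O t (mon b s)@_u) *: 'X_[t + u])).
  rewrite (sum_mon (F := fun s b => (a * alpha_term O t b) *: 'X_[t + s])) //.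
  by move=> u; rewrite rmorph0 mulr0 scale0r.
by move=> u; rewrite big1 // => v _; rewrite mul0r scale0r.
Qed.

Lemma graded_ind (P : graded O -> Prop) :
  P 0 -> (forall p q, P p -> P q -> P (p + q)) ->
  (forall a t, P (a *: 'X_[t] : {mpoly R[n]})) -> forall p, P p.
Proof.
by move=> P0 PD PX p; rewrite [p]mpolyE; apply: (big_ind P) => // t _.
Qed.

Let mul0g p : graded_mul (0 : graded O) p = 0.
Proof. by apply: (addIr (graded_mul 0 p)); rewrite -graded_mulDl !add0r. Qed.

Let mulg0 p : graded_mul p (0 : graded O) = 0.
Proof. by apply: (addIr (graded_mul p 0)); rewrite -graded_mulDr !add0r. Qed.

Lemma graded_mulA : associative (@graded_mul R n O).
Proof.
move=> p q r; elim/graded_ind: p => [|p p' IH IH'|a t].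
- by rewrite !mul0g.
- by rewrite !graded_mulDl IH IH'.
elim/graded_ind: q => [|q q' IH IH'|b s].
- by rewrite !(mul0g, mulg0).
- by rewrite !(graded_mulDl, graded_mulDr) IH IH'.
elim/graded_ind: r => [|r r' IH IH'|c v].
- by rewrite !mulg0.
- by rewrite !graded_mulDr IH IH'.
by rewrite !graded_mul_mon rmorphM alpha_termD mulrA addmA.
Qed.

Definition graded_one : graded O := 'X_[0].

Let graded_oneE : graded_one = 1 *: ('X_[0] : {mpoly R[n]}).
Proof. by rewrite scale1r. Qed.

Lemma graded_mul1 : left_id graded_one (@graded_mul R n O).
Proof.
move=> p; elim/graded_ind: p => [|p q IH IH'|a t].
- by rewrite mulg0.
- by rewrite graded_mulDr IH IH'.
by rewrite graded_oneE graded_mul_mon alpha_term0 mul1r add0m.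
Qed.

Lemma graded_mulr1 : right_id graded_one (@graded_mul R n O).
Proof.
move=> p; elim/graded_ind: p => [|p q IH IH'|a t].
- by rewrite mul0g.
- by rewrite graded_mulDl IH IH'.
by rewrite graded_oneE graded_mul_mon rmorph1 mulr1 addm0.
Qed.

Lemma graded_one_neq0 : graded_one != 0.
Proof. by rewrite /graded_one mpolyX0; exact: (oner_neq0 {mpoly R[n]}). Qed.

HB.instance Definition _ := GRing.Zmodule_isNzRing.Build (graded O)
  graded_mulA graded_mul1 graded_mulr1 graded_mulDl graded_mulDr
  graded_one_neq0.

End GradedRing.

(** * Term orderings and maximal monomials *)

Definition strict (T : eqType) (le : rel T) (x y : T) : Prop :=
  le x y && (x != y).

Definition term_order (n : nat) (le : rel 'X_{1..n}) : Prop :=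
  [/\ total le, antisymmetric le, transitive le, well_founded (strict le)
    & forall t x y, le x y -> le (t + x)%MM (t + y)%MM].

(* The term t e_l of R^m is represented by the pair (t, l). *)
Definition module_term_order (n m : nat) (leT : rel 'X_{1..n})
    (le : rel ('X_{1..n} * 'I_m)) : Prop :=
  [/\ total le, antisymmetric le, transitive le & well_founded (strict le)] /\
  (forall t (x y : 'X_{1..n} * 'I_m),
     le x y -> le ((t + x.1)%MM, x.2) ((t + y.1)%MM, y.2)) /\
  (forall (t s : 'X_{1..n}) (x : 'X_{1..n} * 'I_m),
     leT t s -> le ((t + x.1)%MM, x.2) ((s + x.1)%MM, x.2)).

(* The monomial c t of R is represented by the pair (c, t), subject to c != 0;
   mmap sends a formal left combination of terms to its value in the Ore
   extension, the variables being multiplied in increasing order. *)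
Definition is_max_monomial (R : nzRingType) (n m : nat) (O : mvOre R n)
    (le : rel ('X_{1..n} * 'I_m)) (f : 'rV[O]_m)
    (mu : R * 'X_{1..n}) (l : 'I_m) : Prop :=
  exists p : 'I_m -> {mpoly R[n]},
    [/\ forall k, f 0 k = mmap (ore_inj O) (@ore_var R n O) (p k),
        mu.1 != 0, (p l)@_(mu.2) = mu.1
      & forall k s, s \in msupp (p k) -> le (s, k) (mu.2, l)].

(** * Monomials *)

Section Monomials.
Variables (R : idomainType) (n m : nat) (O : mvOre R n).
Implicit Types mu nu : R * 'X_{1..n}.

Definition rdvd (a b : R) : Prop := exists q, b = q * a.

Definition is_lcm (s : seq R) (d : R) : Prop :=
  (forall a, a \in s -> rdvd a d) /\
  (forall e, (forall a, a \in s -> rdvd a e) -> rdvd d e).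

Definition gmon mu : graded O := mu.1 *: ('X_[mu.2] : {mpoly R[n]}).

Definition is_gmon (q : graded O) : Prop := exists2 mu, mu.1 != 0 & q = gmon mu.

Definition mon_dvd mu nu : Prop := exists2 q, is_gmon q & gmon nu = q * gmon mu.

(* The quotient nu / mu; meaningful only when [mon_dvd mu nu]. *)
Definition mon_quo nu mu : graded O :=
  epsilon (inhabits 0) (fun q => is_gmon q /\ gmon nu = q * gmon mu).

Definition mon_assoc mu nu : Prop :=
  mu.2 = nu.2 /\ exists2 v : R, v \is a GRing.unit & nu.1 = v * mu.1.

(** * Least common multiples, S-pairs, useful sets *)

(* A family of N leading monomials: mu i = (c_i, tau_i) is its i-th monomial
   and pos i = l_i the index of its basis element.  As least common multiples
   in R are only determined up to a unit, the coefficients c(i,j) and c(i,j,k)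
   are carried along as arbitrary admissible choices c2 and c3. *)
Section Family.
Variable N : nat.
Variables (mu : 'I_N -> R * 'X_{1..n}) (pos : 'I_N -> 'I_m).
Variables (c2 : 'I_N -> 'I_N -> R) (c3 : 'I_N -> 'I_N -> 'I_N -> R).
Implicit Types i j k : 'I_N.

Definition tau2 i j : 'X_{1..n} := mlcm (mu i).2 (mu j).2.
Definition tau3 i j k : 'X_{1..n} := mlcm (tau2 i j) (mu k).2.
Definition mu2 i j := (c2 i j, tau2 i j).
Definition mu3 i j k := (c3 i j k, tau3 i j k).

Definition lcm2_choice : Prop := forall i j, pos i = pos j ->
  is_lcm [:: alpha_term O (tau2 i j - (mu i).2) (mu i).1;
             alpha_term O (tau2 i j - (mu j).2) (mu j).1] (c2 i j)
  /\ c2 i j = c2 j i.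

Definition lcm3_choice : Prop := forall i j k, pos i = pos j -> pos j = pos k ->
  is_lcm [:: alpha_term O (tau3 i j k - tau2 i j) (c2 i j);
             alpha_term O (tau3 i j k - tau2 i k) (c2 i k);
             alpha_term O (tau3 i j k - tau2 j k) (c2 j k)] (c3 i j k).

Definition spair i j : 'rV[graded O]_N :=
  mon_quo (mu2 i j) (mu j) *: delta_mx 0 j
  - mon_quo (mu2 i j) (mu i) *: delta_mx 0 i.

Definition redundant i j : Prop :=
  (exists k, [/\ (j < k)%N, pos k = pos i, pos k = pos j,
      mon_assoc (mu3 i j k) (mu2 i j)
    & ~ mon_assoc (mu2 i k) (mu2 i j) /\ ~ mon_assoc (mu2 i j) (mu2 j k)])
  \/
  (exists k, [/\ (k < j)%N, pos k = pos i, pos k = pos j,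
      mon_dvd (mu2 j k) (mu2 i j)
    & ~ mon_assoc (mu2 i j) (mu2 j k)]).

Definition lead_map (h : 'rV[graded O]_N) : 'rV[graded O]_m :=
  \sum_i h 0 i *: (gmon (mu i) *: delta_mx 0 (pos i)).

Definition homogeneous (h : 'rV[graded O]_N) : Prop :=
  exists (a : 'I_N -> R) (lam : 'I_N -> 'X_{1..n}),
    h = \sum_i gmon (a i, lam i) *: delta_mx 0 i /\
    forall i j, a i != 0 -> a j != 0 ->
      (lam i + (mu i).2)%MM = (lam j + (mu j).2)%MM /\ pos i = pos j.

Definition generates (B K : 'rV[graded O]_N -> Prop) : Prop :=
  (forall b, B b -> K b) /\
  forall h, K h -> exists (r : nat) (q : 'I_r -> graded O)
      (b : 'I_r -> 'rV[graded O]_N),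
    (forall l, B (b l)) /\ h = \sum_(l < r) q l *: b l.

Definition left_gm_set (B : 'rV[graded O]_N -> Prop) : Prop :=
  generates B (fun h => lead_map h = 0) /\ forall b, B b -> homogeneous b.

(* A set of pairs {i,j} with i < j is given as a relation on the ordered
   pairs (i,j). *)
Definition useful_pairs (GM : 'I_N -> 'I_N -> Prop) : Prop :=
  (forall i j, GM i j -> (i < j)%N /\ pos i = pos j) /\
  left_gm_set (fun b => exists i j, GM i j /\ b = spair i j).

End Family.

(* [useful_pairs] for the family of the first N' members of a family of size
   N; the pairs are given by the indices of the large family. *)
Definition useful_pairs_upto (N N' : nat) (le_N : (N' <= N)%N)
    (mu : 'I_N -> R * 'X_{1..n}) (pos : 'I_N -> 'I_m)
    (c2 : 'I_N -> 'I_N -> R) (GM : 'I_N -> 'I_N -> Prop) : Prop :=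
  let w := widen_ord le_N in
  (forall i j, GM i j -> (i < N')%N /\ (j < N')%N) /\
  useful_pairs (fun i => mu (w i)) (fun i => pos (w i))
    (fun i j => c2 (w i) (w j)) (fun i j => GM (w i) (w j)).

(** * Updating a useful set by one more element *)

Section Update.
Variables (N : nat) (mu : 'I_N -> R * 'X_{1..n}) (pos : 'I_N -> 'I_m).
Variables (c2 : 'I_N -> 'I_N -> R) (s : 'I_N).

Definition Mbar nu : Prop :=
  exists j : 'I_N, [/\ (j < s)%N, pos j = pos s & nu = mu2 mu c2 j s].

Definition Mbar' nu : Prop :=
  Mbar nu /\
  exists nu', [/\ Mbar nu', mon_dvd nu' nu & ~ mon_assoc nu nu'].

End Update.

End Monomials.

(* Main.v *)
Require Import Defs.
From HB Require Import structures.
From mathcomp Require Import all_boot all_order all_algebra.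
From mathcomp Require Import mpoly.
From Stdlib Require Import ClassicalEpsilon.

(* Compare a homogeneous syzygy h of the monomials with its last index s: its
   coefficient a at s satisfies a d_s \in (d_i : i < s), where d_i is the image
   of c_i under the automorphism lifting tau_i to the degree of h.  Ideals of a
   principal ideal domain form a distributive lattice, so a d_s lies in the sum
   of the ideals (lcm(d_i, d_s)), and subtracting multiples of the b(i,s) kills
   the coefficient at s.  Hence all b(i,s) with i < s, together with generators
   of the syzygies of the elements before s, generate everything.  For (3), if
   mu(j,s) divides mu(i,s) then b(i,s) is a multiple of b(j,s) plus a syzygy of
   the elements before s, so the minimal mu(j,s) suffice.  For (2), the cocycle
   relation (1) rewrites a redundant b(i,j) in terms of two S-pairs that are
   smaller for the lexicographic order on mu(i,j) (by strict divisibility) and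
   max(i,j). *)

Set Implicit Arguments.
Unset Strict Implicit.
Unset Printing Implicit Defensive.

Import GRing.Theory.
Local Open Scope ring_scope.

(** * Divisibility, least common multiples and ideals in the coefficient ring *)

Lemma rdvd_anti (R : idomainType) (a b : R) : a != 0 -> rdvd a b -> rdvd b a ->
  exists2 v, v \is a GRing.unit & b = v * a.
Proof.
move=> a0 [p bE] [q aE]; exists p => //; apply/unitrP; exists q.
suff qp : q * p = 1 by split=> //; rewrite mulrC.
by apply: (mulIf a0); rewrite -mulrA -bE -aE mul1r.
Qed.

(** The product of the entries is a nonzero common multiple, and [d] divides it. *)
Lemma is_lcm_neq0 (R : idomainType) (s : seq R) (d : R) :
  is_lcm s d -> (forall a, a \in s -> a != 0) -> d != 0.
Proof.
case=> _ min_d s0; have pi a : a \in s -> rdvd a (\prod_(b <- s) b).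
  by move=> sa; rewrite (big_rem a) //= mulrC; eexists.
have [q prodE] := min_d _ pi.
suff : \prod_(b <- s) b != 0 by apply: contraNneq => d0; rewrite prodE d0 mulr0.
by rewrite prodf_seq_neq0; apply/allP => a /s0.
Qed.

(* Write x_i = x'_i g with g a gcd and 1 = sum_i c_i x'_i; then y_i = c_i x'_i
   works.  A common multiple z of g and d is thus a sum of common multiples
   y_i z of x_i and d, which is the distributivity used below. *)
Lemma pid_split (R : idomainType) (I : finType) (P : pred I) (x : I -> R) (z : R) :
  principal_ideal_domain R ->
  (exists c, z = \sum_(i | P i) c i * x i) ->
  exists y, z = \sum_(i | P i) y i * z /\ forall i, P i -> rdvd (x i) (y i * z).
Proof.
move=> pid z_in; pose J (w : R) := exists c, w = \sum_(i | P i) c i * x i.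
have [|g gP] := pid J.
  split; first by exists (fun=> 0); rewrite big1 // => i _; rewrite mul0r.
    move=> _ _ [c ->] [e ->]; exists (fun i => c i + e i).
    by rewrite -big_split; apply: eq_bigr => i _; rewrite mulrDl.
  move=> a _ [c ->]; exists (fun i => a * c i).
  by rewrite mulr_sumr; apply: eq_bigr => i _; rewrite mulrA.
have [b zE] := (gP z).1 z_in.
have [g0|g0] := eqVneq g 0.
  have z0 : z = 0 by rewrite zE g0 mulr0.
  exists (fun=> 0); rewrite z0; split; first by rewrite big1 // => i; rewrite mulr0.
  by move=> i _; exists 0; rewrite !mul0r.
have xP i : exists x', P i -> x i = x' * g.
  case Pi: (P i); last by exists 0.
  have [|x' ->] := (gP (x i)).1; last by exists x'.
  exists (fun j => (j == i)%:R); rewrite (bigD1 i) //= eqxx mul1r big1 ?addr0 //.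
  by move=> j /andP[_ /negPf->]; rewrite mul0r.
pose x' i := sval (constructive_indefinite_description _ (xP i)).
have x'E i : P i -> x i = x' i * g.
  exact: (svalP (constructive_indefinite_description _ (xP i))).
have [c gE] : J g by apply/gP; exists 1; rewrite mul1r.
have c1 : \sum_(i | P i) c i * x' i = 1.
  apply: (mulIf g0); rewrite mul1r mulr_suml {2}gE; apply: eq_bigr => i Pi.
  by rewrite -mulrA x'E.
exists (fun i => c i * x' i); split; first by rewrite -mulr_suml c1 mul1r.
by move=> i Pi; exists (c i * b); rewrite zE x'E // mulrACA.
Qed.

(** * Left spans in a module over a noncommutative ring *)

Section Spans.

Variables (A : nzRingType) (V : lmodType A).
Implicit Types (B : V -> Prop) (v w : V).

(** Has the shape of the generation clause of [generates], so the two are interchangeable. *)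
Definition lspan B v : Prop :=
  exists (r : nat) (q : 'I_r -> A) (b : 'I_r -> V),
    (forall l, B (b l)) /\ v = \sum_(l < r) q l *: b l.

Lemma lspan0 B : lspan B 0.
Proof. by exists 0%N, (fun=> 0), (fun=> 0); rewrite big_ord0; split=> // -[]. Qed.

Lemma mem_lspan B v : B v -> lspan B v.
Proof. by exists 1%N, (fun=> 1), (fun=> v); rewrite big_ord1 scale1r. Qed.

Lemma lspanZ B a v : lspan B v -> lspan B (a *: v).
Proof.
move=> [r [q [b [Bb ->]]]]; exists r, (fun l => a * q l), b; split=> //.
by rewrite scaler_sumr; apply: eq_bigr => l _; rewrite scalerA.
Qed.

Lemma lspanD B v w : lspan B v -> lspan B w -> lspan B (v + w).
Proof.
move=> [r [q [b [Bb ->]]]] [r' [q' [b' [Bb' ->]]]].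
exists (r + r')%N, (fun l => match split l with inl i => q i | inr i => q' i end),
  (fun l => match split l with inl i => b i | inr i => b' i end).
split=> [l|]; first by case: (split l).
rewrite big_split_ord /=; congr (_ + _); apply: eq_bigr => i _.
  by rewrite (unsplitK (inl i)).
by rewrite (unsplitK (inr i)).
Qed.

Lemma lspanN B v : lspan B v -> lspan B (- v).
Proof. by rewrite -scaleN1r; apply: lspanZ. Qed.

Lemma lspan_ind B (K : V -> Prop) : K 0 ->
  (forall a v w, K v -> K w -> K (a *: v + w)) -> (forall b, B b -> K b) ->
  forall v, lspan B v -> K v.
Proof.
move=> K0 KD KB _ [r [q [b [Bb ->]]]].
apply: (big_ind K) => // [x y Kx Ky|l _]; first by rewrite -(scale1r x); apply: KD.
by rewrite -[_ *: _]addr0; apply: KD => //; apply: KB.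
Qed.

Lemma lspan_trans B B' v : (forall b, B b -> lspan B' b) -> lspan B v -> lspan B' v.
Proof.
move=> BB'; apply: (@lspan_ind B (lspan B')) => //; first exact: lspan0.
by move=> a x y B'x B'y; apply: lspanD => //; apply: lspanZ.
Qed.

End Spans.

Lemma lspan_map (A : nzRingType) (V W : lmodType A) (f : {linear V -> W})
    (B : V -> Prop) (B' : W -> Prop) v :
  (forall b, B b -> B' (f b)) -> lspan B v -> lspan B' (f v).
Proof.
move=> BB'; apply: (@lspan_ind _ _ B (fun v => lspan B' (f v))) => [|a x y|b Bb].
  by rewrite linear0; apply: lspan0.
  by move=> Bx By; rewrite linearP; apply: lspanD => //; apply: lspanZ.
by apply: mem_lspan; apply: BB'.
Qed.

(** * Twisted monomials: coefficients of products, divisibility, quotients *)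

Section TwistedMonomials.

Variables (R : idomainType) (n m : nat) (O : mvOre R n).
Hypothesis autR : forall i : 'I_n, bijective (ore_alphaR O i).
Implicit Types (mu nu : R * 'X_{1..n}) (p q : graded O) (t : 'X_{1..n}).

Lemma alpha_term_bij t : bijective (alpha_term O t).
Proof.
rewrite /alpha_term; elim: (enum _) => [|i e IH] /=; first by exists id.
apply: bij_comp IH; elim: (t i) => [|k IH] /=; first by exists id.
exact: bij_comp.
Qed.

Lemma alpha_term_eq0 t a : (alpha_term O t a == 0) = (a == 0).
Proof. exact: raddf_eq0 (bij_inj (alpha_term_bij t)). Qed.

(** From left to right the quotient is pulled back along [alpha_term O t], which uses
    surjectivity. *)
Lemma rdvd_alpha t a b :
  rdvd (alpha_term O t a) (alpha_term O t b) <-> rdvd a b.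
Proof.
split=> -[q].
  have [f fK Kf] := alpha_term_bij t; rewrite -{1}(Kf q) -rmorphM.
  by move/(bij_inj (alpha_term_bij t)) => ->; exists (f q).
by move=> ->; exists (alpha_term O t q); rewrite rmorphM.
Qed.

Lemma gmonM mu nu :
  gmon O mu * gmon O nu = gmon O (mu.1 * alpha_term O mu.2 nu.1, (mu.2 + nu.2)%MM).
Proof. exact: graded_mul_mon. Qed.

Lemma mcoeff_gmon mu t : (gmon O mu)@_t = mu.1 *+ (mu.2 == t).
Proof. by rewrite /gmon mcoeffZ mcoeffX; case: eqP => _; rewrite ?mulr1 ?mulr0. Qed.

Lemma gmon_inj mu nu : mu.1 != 0 -> gmon O mu = gmon O nu -> mu = nu.
Proof.
case: mu nu => [a t] [b s] /= a0 E.
have := congr1 (mcoeff t) E; rewrite !mcoeff_gmon /= eqxx.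
rewrite mulr1n; case: eqP => [-> ->|_ a_eq]; first by rewrite mulr1n.
by rewrite a_eq eqxx in a0.
Qed.

(** Right multiplication by a monomial shifts all terms by [mu.2], so a single term of [p]
    contributes. *)
Lemma mcoeff_mulgmon p mu t :
  (p * gmon O mu)@_(t + mu.2) = p@_t * alpha_term O t mu.1.
Proof.
elim/graded_ind: p => [|p q IHp IHq|a s].
- by rewrite mul0r !mcoeff0 mul0r.
- by rewrite mulrDl mcoeffD IHp IHq mcoeffD mulrDl.
rewrite -/(gmon O (a, s)) gmonM !mcoeff_gmon /= eqm_add2r.
by case: eqP => [->|_]; rewrite // mul0r.
Qed.

Lemma mcoeff_mulgmon_eq0 p mu t : ~~ (mu.2 <= t)%MM -> (p * gmon O mu)@_t = 0.
Proof.
move=> tN; elim/graded_ind: p => [|p q IHp IHq|a s].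
- by rewrite mul0r mcoeff0.
- by rewrite mulrDl mcoeffD IHp IHq addr0.
rewrite -/(gmon O (a, s)) gmonM mcoeff_gmon /=.
by case: eqP tN => // <-; rewrite lem_addl.
Qed.

Lemma mulIgmon mu : mu.1 != 0 -> injective (fun p => p * gmon O mu).
Proof.
move=> mu0 p q /= E; apply/mpolyP => t; apply: (mulIf (_ : alpha_term O t mu.1 != 0)).
  by rewrite alpha_term_eq0.
by rewrite -!mcoeff_mulgmon E.
Qed.

Lemma mon_dvdP mu nu : mu.1 != 0 -> nu.1 != 0 ->
  mon_dvd O mu nu <->
  (mu.2 <= nu.2)%MM /\ rdvd (alpha_term O (nu.2 - mu.2) mu.1) nu.1.
Proof.
move=> mu0 nu0; split.
  case=> _ [x x0 ->]; rewrite gmonM => /(gmon_inj nu0) ->/=.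
  by rewrite lem_addl addmK; split=> //; exists x.1.
case=> le_t [q nuE]; exists (gmon O (q, (nu.2 - mu.2)%MM)).
  by eexists; last reflexivity; apply: contraNneq nu0 => /= q0; rewrite nuE q0 mul0r.
by rewrite gmonM /= submK // -nuE; case: (nu).
Qed.

Lemma mon_dvd_refl mu : mon_dvd O mu mu.
Proof.
exists 1; last by rewrite mul1r.
by exists (1, 0%MM); rewrite ?oner_neq0 // /gmon scale1r.
Qed.

Lemma mon_dvd_trans mu nu rho : mu.1 != 0 ->
  mon_dvd O rho mu -> mon_dvd O mu nu -> mon_dvd O rho nu.
Proof.
move=> mu0 [_ [x x0 ->] E] [_ [y y0 ->] E']; exists (gmon O y * gmon O x).
  by rewrite gmonM; eexists; last reflexivity; rewrite /= mulf_neq0 ?alpha_term_eq0.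
by rewrite E' E mulrA.
Qed.

Lemma mon_assoc_dvd mu nu : mon_assoc mu nu -> mon_dvd O mu nu.
Proof.
case: mu nu => [a t] [b s] [/= <- [v uv ->]]; exists (gmon O (v, 0%MM)).
  by eexists; last reflexivity; apply: contraTneq uv => /= ->; rewrite unitr0.
by rewrite gmonM /= alpha_term0 add0m.
Qed.

Lemma mon_assoc_sym mu nu : mon_assoc mu nu -> mon_assoc nu mu.
Proof.
rewrite /mon_assoc => -[-> [v uv E]]; split=> //; exists v^-1; rewrite ?unitrV //.
by rewrite E mulKr.
Qed.

Lemma mon_dvd_anti mu nu : mu.1 != 0 -> nu.1 != 0 ->
  mon_dvd O mu nu -> mon_dvd O nu mu -> mon_assoc mu nu.
Proof.
move=> mu0 nu0 /(mon_dvdP mu0 nu0)[le1 dvd1] /(mon_dvdP nu0 mu0)[le2 dvd2].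
have E : mu.2 = nu.2.
  by apply/mnmP => i; apply/eqP; rewrite eqn_leq (mnm_lepP le1) (mnm_lepP le2).
have sub0 : (mu.2 - mu.2 = 0)%MM by apply/mnmP => i; rewrite mnmBE subnn mnm0E.
move: dvd1 dvd2; rewrite -E sub0 !alpha_term0 => dvd1 dvd2.
by split=> //; apply: rdvd_anti.
Qed.

Lemma mon_quoP mu nu : mon_dvd O mu nu ->
  is_gmon (mon_quo O nu mu) /\ gmon O nu = mon_quo O nu mu * gmon O mu.
Proof.
case=> q gq E; rewrite /mon_quo; set P := (P in epsilon _ P).
by apply: (@epsilon_spec _ (inhabits 0) P); exists q.
Qed.

(** Both sides give [nu] when multiplied by [rho] on the right, and [rho] cancels. *)
Lemma mon_quo_comp mu nu rho : rho.1 != 0 -> mu.1 != 0 ->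
  mon_dvd O rho mu -> mon_dvd O mu nu ->
  mon_quo O nu mu * mon_quo O mu rho = mon_quo O nu rho.
Proof.
move=> rho0 mu0 d1 d2; apply: (mulIgmon rho0).
rewrite -mulrA -(mon_quoP d1).2 -(mon_quoP d2).2.
exact: (mon_quoP (mon_dvd_trans mu0 d1 d2)).2.
Qed.

End TwistedMonomials.

(** The telescoping behind the cocycle relation: [x], [y], [z] stand for the terms at the indices
    [i], [j], [k]. *)
Lemma sub_cocycle (V : zmodType) (x y z : V) : z - x - (y - x) + (y - z) = 0.
Proof. by rewrite opprB [X in X + _]addrA subrK addrA subrK subrr. Qed.

(** * S-pairs of a family of leading monomials and the map [lead_map] *)

Section Family.

Variables (R : idomainType) (n m : nat) (O : mvOre R n).
Hypothesis autR : forall i : 'I_n, bijective (ore_alphaR O i).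
Variables (N : nat) (mu : 'I_N -> R * 'X_{1..n}) (pos : 'I_N -> 'I_m).
Variable c2 : 'I_N -> 'I_N -> R.
Hypothesis mu_neq0 : forall i, (mu i).1 != 0.
Hypothesis lcm2 : lcm2_choice O mu pos c2.
Implicit Types (i j k s : 'I_N) (nu : R * 'X_{1..n}) (h v : 'rV[graded O]_N).

Local Notation mu2 := (mu2 mu c2).
Local Notation b := (spair O mu c2).
Local Notation lead := (@lead_map R n m O N mu pos).
Local Notation dvd := (mon_dvd O).
Local Notation quo := (mon_quo O).

Lemma mu2C i j : pos i = pos j -> mu2 i j = mu2 j i.
Proof. by move=> ij; rewrite /Defs.mu2 (lcm2 ij).2 /tau2 mlcmC. Qed.

Lemma mu2_neq0 i j : pos i = pos j -> (mu2 i j).1 != 0.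
Proof.
move=> ij; apply: is_lcm_neq0 (lcm2 ij).1 _ => a; rewrite !inE.
by case/orP=> /eqP->; rewrite alpha_term_eq0.
Qed.

Lemma mu_dvd_mu2l i j : pos i = pos j -> dvd (mu i) (mu2 i j).
Proof.
move=> ij; apply/mon_dvdP => //; first exact: mu2_neq0.
by rewrite lem_mlcml; split=> //; apply: (lcm2 ij).1.1; rewrite mem_head.
Qed.

Lemma mu_dvd_mu2r i j : pos i = pos j -> dvd (mu j) (mu2 i j).
Proof. by move=> ij; rewrite mu2C //; apply: mu_dvd_mu2l. Qed.

(** The lcm property of [c2 i j] lives in degree [tau2 mu i j]; divisibility in the degree of [nu]
    is brought down to it by the inverse [f] of an automorphism. *)
Lemma mu2_min i j nu : pos i = pos j -> nu.1 != 0 ->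
  dvd (mu i) nu -> dvd (mu j) nu -> dvd (mu2 i j) nu.
Proof.
move=> ij nu0 /mon_dvdP[] // le_i dvd_i /mon_dvdP[] // le_j dvd_j.
have le2 : (tau2 mu i j <= nu.2)%MM by rewrite lem_mlcm le_i.
apply/mon_dvdP => //; first exact: mu2_neq0.
split=> //=; have [f fK Kf] := alpha_term_bij autR (nu.2 - tau2 mu i j).
rewrite -(Kf nu.1); apply/rdvd_alpha => //; apply: (lcm2 ij).1.2 => a.
have split_alpha k : ((mu k).2 <= tau2 mu i j)%MM ->
    rdvd (alpha_term O (nu.2 - (mu k).2) (mu k).1) nu.1 ->
    rdvd (alpha_term O (tau2 mu i j - (mu k).2) (mu k).1) (f nu.1).
  move=> le_k dvd_k; apply/(rdvd_alpha autR (nu.2 - tau2 mu i j)).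
  by rewrite Kf -alpha_termD addmBA // submK.
rewrite !inE => /orP[] /eqP->; apply: split_alpha => //.
  exact: lem_mlcml.
exact: lem_mlcmr.
Qed.

Lemma spairN i j : pos i = pos j -> b i j = - b j i.
Proof. by move=> ij; rewrite /spair mu2C // opprB. Qed.

Lemma spairii i : b i i = 0.
Proof. exact: subrr. Qed.

(** Lifted to a common multiple [nu], an S-pair is a difference of two terms, each depending on one
    index only; this makes sums of S-pairs telescope. *)
Lemma quo_spair nu i j : pos i = pos j -> dvd (mu2 i j) nu ->
  quo nu (mu2 i j) *: b i j
  = quo nu (mu j) *: delta_mx 0 j - quo nu (mu i) *: delta_mx 0 i.
Proof.
move=> ij dvd_nu; rewrite /spair scalerBr !scalerA.
by rewrite !mon_quo_comp //; do ?[exact: mu2_neq0 | exact: mu_dvd_mu2l | exact: mu_dvd_mu2r].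
Qed.

Lemma mon_quo_refl nu : nu.1 != 0 -> quo nu nu = 1.
Proof.
move=> nu0; apply: (mulIgmon autR nu0).
by rewrite mul1r -(mon_quoP (mon_dvd_refl O nu)).2.
Qed.

(** The cocycle relation lifted to [mu2 i j] itself, where the factor of [b i j] is 1. *)
Lemma spair_trans i j k : pos i = pos j -> pos k = pos j ->
  dvd (mu2 i k) (mu2 i j) -> dvd (mu2 k j) (mu2 i j) ->
  b i j = quo (mu2 i j) (mu2 i k) *: b i k + quo (mu2 i j) (mu2 k j) *: b k j.
Proof.
move=> ij kj dvd1 dvd2; rewrite !quo_spair ?ij ?kj //.
rewrite addrC addrA subrK -[LHS]scale1r -(mon_quo_refl (mu2_neq0 ij)).
by rewrite quo_spair //; apply: mon_dvd_refl.
Qed.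

Lemma lead_map_is_linear : linear lead.
Proof.
move=> a v h; rewrite /lead_map scaler_sumr -big_split; apply: eq_bigr => i _.
by rewrite !mxE /= scalerDl !scalerA.
Qed.

HB.instance Definition _ :=
  GRing.isLinear.Build (graded O) 'rV[graded O]_N 'rV[graded O]_m _ lead lead_map_is_linear.

Lemma lead_mapE h l : lead h 0 l = \sum_(i | pos i == l) h 0 i * gmon O (mu i).
Proof.
rewrite /lead_map summxE [RHS]big_mkcond; apply: eq_bigr => i _.
rewrite mxE mxE mxE (eq_sym l); case: (pos i == l); first by rewrite mulr1.
by rewrite !mulr0.
Qed.

Lemma lead_delta p i : lead (p *: delta_mx 0 i) = (p * gmon O (mu i)) *: delta_mx 0 (pos i).
Proof.
rewrite /lead_map (bigD1 i) //= big1 ?addr0 => [|j /negPf ji]; last first.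
  by rewrite !mxE ji mulr0 scale0r.
by rewrite !mxE !eqxx mulr1 scalerA.
Qed.

Lemma lead_spair i j : pos i = pos j -> lead (b i j) = 0.
Proof.
move=> ij; rewrite /spair linearB /= !lead_delta ij.
by rewrite -(mon_quoP (mu_dvd_mu2r ij)).2 -(mon_quoP (mu_dvd_mu2l ij)).2 subrr.
Qed.

Lemma homogeneous_spair i j : i != j -> pos i = pos j -> homogeneous mu pos (b i j).
Proof.
move=> ij pij; rewrite /spair.
have [[x x0 ->] xE] := mon_quoP (mu_dvd_mu2r pij).
have [[y y0 ->] yE] := mon_quoP (mu_dvd_mu2l pij).
rewrite !gmonM in xE yE; have {}xE := congr1 snd (gmon_inj (mu2_neq0 pij) xE).
have {}yE := congr1 snd (gmon_inj (mu2_neq0 pij) yE).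
(* The common degree is [tau2 mu i j]. Away from [i] and [j] the value of [lam] is arbitrary, since
   [a] vanishes there. *)
pose a k := if k == j then x.1 else if k == i then - y.1 else 0.
pose lam k := if k == j then x.2 else y.2.
have deg k : a k != 0 -> (lam k + (mu k).2)%MM = tau2 mu i j /\ pos k = pos j.
  rewrite /a /lam; have [-> _|_] := eqVneq k j; first exact: conj (esym xE) _.
  by have [-> _|_ /eqP] := eqVneq k i; first exact: conj (esym yE) _.
exists a, lam; split=> [|k l /deg[-> ->] /deg[-> ->]] //.
rewrite /a /lam (bigD1 j) //= (bigD1 i) //= eqxx (negPf ij) eqxx big1 ?addr0.
  by rewrite -scaleNr; congr (_ + _ *: _); apply: esym (scaleNr _ _).
by move=> k /andP[/negPf-> /negPf->]; rewrite /gmon scale0r scale0r.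
Qed.

Lemma coef_spair_top i s : i != s -> (b i s) 0 s = quo (mu2 i s) (mu s).
Proof.
by move=> is_; rewrite !mxE !eqxx eq_sym (negPf is_) mulr1 mulr0 subr0.
Qed.

Lemma coef_spair_out i j k : k != i -> k != j -> (b i j) 0 k = 0.
Proof. by move=> /negPf ki /negPf kj; rewrite !mxE ki kj !mulr0 subr0. Qed.

Definition top_pair s v := exists i, [/\ (i < s)%N, pos i = pos s & v = b i s].

Lemma lspan_top_out s k v : (s < k)%N -> lspan (top_pair s) v -> v 0 k = 0.
Proof.
move=> sk; apply: (@lspan_ind _ _ _ (fun v => v 0 k = 0)); first by rewrite mxE.
  by move=> a x y; rewrite !mxE => -> ->; rewrite mulr0 addr0.
move=> _ [i [lt_is _ ->]]; apply: coef_spair_out; rewrite neq_ltn ?sk ?orbT //.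
by rewrite (ltn_trans lt_is sk) orbT.
Qed.

Lemma lspan_top_lead s v : lspan (top_pair s) v -> lead v = 0.
Proof.
apply: (@lspan_ind _ _ _ (fun v => lead v = 0)); first exact: linear0.
  by move=> a x y x0 y0; rewrite linearP /= x0 y0 scaler0 addr0.
by move=> _ [i [_ pos_i ->]]; apply: lead_spair.
Qed.

(** * Generation of the syzygies by elimination of the last coefficient *)

Hypothesis pid : principal_ideal_domain R.

Lemma top_coef_lspan h s : lead h = 0 -> (forall i, (s < i)%N -> h 0 i = 0) ->
  exists v, lspan (top_pair s) v /\ v 0 s = h 0 s.
Proof.
move=> lead_h h_top; pose I p := exists v, lspan (top_pair s) v /\ v 0 s = p.
have I0 : I 0 by exists 0; split; [exact: lspan0 | rewrite mxE].
have ID p q : I p -> I q -> I (p + q).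
  move=> [v [Bv <-]] [w [Bw <-]]; exists (v + w).
  by split; [exact: lspanD | rewrite mxE].
have Isum (J : Type) (r : seq J) (Q : pred J) (F : J -> graded O) :
    (forall x, Q x -> I (F x)) -> I (\sum_(x <- r | Q x) F x).
  by move=> IF; apply: (big_ind I).
(* The attainable coefficients [I] are closed under sums, so one term of [h 0 s] can be treated at a
   time; [h] itself need not be homogeneous. *)
suff It t : I (gmon O ((h 0 s)@_t, t)); first rewrite -/(I (h 0 s)).
  have -> : h 0 s = \sum_(t <- msupp (h 0 s)) gmon O ((h 0 s)@_t, t).
    exact: mpolyE.
  exact: Isum.
(* [T] is the degree that the term [t] at position [s] reaches under [lead], [z] its coefficient
   there, and [P] selects the earlier elements able to reach [T]. *)
set a := (h 0 s)@_t; pose T := (t + (mu s).2)%MM; pose z := a * alpha_term O t (mu s).1.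
pose P i := [&& (i < s)%N, pos i == pos s & ((mu i).2 <= T)%MM].
pose d i := alpha_term O (T - (mu i).2) (mu i).1.
have [|y [zE dvd_y]] := pid_split (P := P) (x := d) (z := z) pid.
  (* Reading the coefficient of [T] in component [pos s] of [lead h = 0] expresses [z] through the
     [d i]: indices above [s] and terms not dividing [T] contribute zero. *)
  exists (fun i => - (h 0 i)@_(T - (mu i).2)).
  pose c i := (h 0 i * gmon O (mu i))@_T.
  have cE i : ((mu i).2 <= T)%MM -> c i = (h 0 i)@_(T - (mu i).2) * d i.
    by move=> le_i; rewrite /c -{1}(submK le_i) mcoeff_mulgmon.
  have c0 i : ~~ ((mu i).2 <= T)%MM -> c i = 0 by apply: mcoeff_mulgmon_eq0.
  have c_top i : (s < i)%N -> c i = 0 by move=> lt_si; rewrite /c h_top // mul0r mcoeff0.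
  have c_s : c s = z by apply: mcoeff_mulgmon.
  have : \sum_(i | pos i == pos s) c i = 0.
    by rewrite -(raddf_sum (mcoeff T)) /= -lead_mapE lead_h mxE mcoeff0.
  rewrite (bigD1 s) //= c_s => /eqP; rewrite addr_eq0 => /eqP->.
  rewrite -sumrN; move: c cE c0 c_top {c_s} => c cE c0 c_top.
  rewrite [RHS]big_mkcond [LHS]big_mkcond /=; apply: eq_bigr => i _; rewrite /P.
  have [lt_is|lt_si|/val_inj->] := ltngtP i s; last by rewrite !eqxx.
    case: eqP => _ //=; rewrite (_ : i != s) ?neq_ltn ?lt_is //.
    by case: ifPn => [/cE->|/c0->]; rewrite ?oppr0 // mulNr.
  by rewrite c_top // oppr0 if_same.
have s0 : alpha_term O t (mu s).1 != 0 by rewrite alpha_term_eq0.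
(* Cancelling the image of the coefficient of [mu s] from [zE] splits [a] itself. *)
have -> : gmon O (a, t) = \sum_(i | P i) gmon O (y i * a, t).
  rewrite /gmon /= -scaler_suml; congr (_ *: _); apply: (mulIf s0).
  by rewrite -/z {1}zE mulr_suml; apply: eq_bigr => i _; rewrite /z mulrA.
apply: Isum => i Pi; have /and3P[lt_is /eqP pos_i le_i] := Pi.
have [ya0|ya0] := eqVneq (y i * a) 0; first by rewrite ya0 /gmon scale0r.
(* [nu] is a common multiple of [mu i] and [mu s], hence of [mu2 i s]; the lift of [b i s] to [nu]
   has coefficient [nu / mu s] at [s], which is the required summand. *)
pose nu := (y i * z, T); have nu0 : nu.1 != 0 by rewrite /= mulrA mulf_neq0.
have i_nu : dvd (mu i) nu by apply/mon_dvdP => //; split; last exact: dvd_y.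
have s_nuE : gmon O nu = gmon O (y i * a, t) * gmon O (mu s).
  by rewrite gmonM /= -mulrA.
have s_nu : dvd (mu s) nu by exists (gmon O (y i * a, t)) => //; eexists; last reflexivity.
have is_nu := mu2_min pos_i nu0 i_nu s_nu.
exists (quo nu (mu2 i s) *: b i s); split; first by apply: lspanZ; apply: mem_lspan; exists i.
rewrite mxE coef_spair_top ?neq_ltn ?lt_is // mon_quo_comp //; last first.
- exact: mu_dvd_mu2r.
- exact: mu2_neq0.
by apply: (mulIgmon autR (mu_neq0 s)); rewrite -(mon_quoP s_nu).2.
Qed.

(** Induction on a bound [k] from which on the coefficients of [h] vanish; each step removes the
    coefficient at the last remaining index. *)
Lemma lspan_ker B h :
  (forall i j, (i < j)%N -> pos i = pos j -> lspan B (b i j)) -> lead h = 0 ->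
  lspan B h.
Proof.
move=> Bb lead_h.
have [k le_k h_top] : exists2 k, (k <= N)%N & forall i, (k <= i)%N -> h 0 i = 0.
  by exists N => // i; rewrite leqNgt ltn_ord.
elim: k le_k h lead_h h_top => [|k IH] lt_k h lead_h h_top.
  by rewrite (_ : h = 0); [exact: lspan0 | apply/rowP => i; rewrite h_top // mxE].
pose s := Ordinal lt_k; have [v [Bv vE]] := top_coef_lspan (s := s) lead_h h_top.
rewrite -(subrK v h); apply: lspanD; last first.
  by apply: lspan_trans Bv => _ [i [lt_is pos_i ->]]; apply: Bb.
apply: IH (ltnW lt_k) _ _ _ => [|i].
  by rewrite linearB /= lead_h (lspan_top_lead Bv) subr0.
rewrite leq_eqVlt => /predU1P[ki|lt_ki].
  by rewrite (_ : i = s) ?mxE ?vE ?subrr //; apply: val_inj.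
by rewrite !mxE h_top // (lspan_top_out (s := s) _ Bv) // subr0.
Qed.

Lemma lead_ker_sub p v w : lead v = 0 -> lead w = 0 -> lead (v - p *: w) = 0.
Proof.
by move=> v0 w0; rewrite -scaleNr addrC lead_map_is_linear v0 w0 scaler0 addr0.
Qed.

(** After the coefficient at [s] is removed with all [b i s], each [b i s] is traded for a multiple
    of some [b j s] in [B]. The quotient of [mu2 i s] by [mu s] factors through [mu2 j s], so the
    difference has coefficient zero at [s] and falls under [B_old]. *)
Lemma lspan_ker_step B s : (forall i, (i <= s)%N) ->
  (forall h, lead h = 0 -> h 0 s = 0 -> lspan B h) ->
  (forall i, (i < s)%N -> pos i = pos s ->
     exists j, [/\ (j < s)%N, pos j = pos s, B (b j s) & dvd (mu2 j s) (mu2 i s)]) ->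
  forall h, lead h = 0 -> lspan B h.
Proof.
move=> s_max B_old B_top h lead_h.
have [|v [Bv vE]] := top_coef_lspan (s := s) lead_h.
  by move=> i; rewrite ltnNge s_max.
rewrite -(subrK v h); apply: lspanD.
  by apply: B_old; rewrite ?linearB /= ?lead_h ?(lspan_top_lead Bv) ?subrr // !mxE vE subrr.
apply: lspan_trans Bv => _ [i [lt_is pos_i ->]].
have [j [lt_js pos_j Bj dvd_j]] := B_top i lt_is pos_i.
rewrite -(subrK (quo (mu2 i s) (mu2 j s) *: b j s) (b i s)); apply: lspanD; last first.
  by apply: lspanZ; apply: mem_lspan.
apply: B_old; first by apply: lead_ker_sub; apply: lead_spair.
have ni : i != s by rewrite neq_ltn lt_is.
have nj : j != s by rewrite neq_ltn lt_js.
have sub0 p (w w' : 'rV[graded O]_N) : w 0 s = p * w' 0 s -> (w - p *: w') 0 s = 0.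
  by move=> E; rewrite !mxE E subrr.
apply: sub0; apply: etrans (coef_spair_top ni) _; rewrite (coef_spair_top nj).
apply: esym (mon_quo_comp _ _ _ _ _) => //; first exact: mu2_neq0.
exact: mu_dvd_mu2r.
Qed.

(** * The cocycle relation and the elimination of redundant S-pairs *)

Lemma spair_cocycle nu i j k : pos i = pos j -> pos j = pos k ->
  dvd (mu2 i j) nu -> dvd (mu2 i k) nu -> dvd (mu2 k j) nu ->
  quo nu (mu2 i k) *: b i k - quo nu (mu2 i j) *: b i j + quo nu (mu2 k j) *: b k j = 0.
Proof.
move=> ij jk dij dik dkj; have ik := etrans ij jk; have kj := esym jk.
rewrite (quo_spair ij dij) (quo_spair ik dik).
rewrite (quo_spair kj dkj).
exact: sub_cocycle.
Qed.

(** S-pairs with distinct indices are homogeneous syzygies, so only generation remains to be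
    checked. *)
Lemma useful_pairsP (GM : 'I_N -> 'I_N -> Prop) :
  (forall i j, GM i j -> (i < j)%N /\ pos i = pos j) ->
  (forall h, lead h = 0 -> lspan (fun v => exists i j, GM i j /\ v = b i j) h) ->
  useful_pairs O mu pos c2 GM.
Proof.
move=> GM_lt GM_gen; split=> //; split; first split=> //.
  by move=> _ [i [j [/GM_lt[_ ij] ->]]]; apply: lead_spair.
move=> _ [i [j [/GM_lt[lt_ij ij] ->]]].
by apply: homogeneous_spair; rewrite // neq_ltn lt_ij.
Qed.

(* Counting pairs makes strict divisibility among the finitely many mu(i,j)
   well-founded, modulo units and without appeal to noetherianity. *)
Definition rank nu : nat :=
  #|[pred p : 'I_N * 'I_N | excluded_middle_informative
      [/\ pos p.1 = pos p.2, dvd (mu2 p.1 p.2) nu & ~ dvd nu (mu2 p.1 p.2)]]|.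

Lemma rank_le nu rho : nu.1 != 0 -> rho.1 != 0 -> dvd nu rho -> (rank nu <= rank rho)%N.
Proof.
move=> nu0 rho0 nu_rho; apply/subset_leq_card/subsetP => p; rewrite !inE.
case: excluded_middle_informative => // -[pos_p p_nu nu_p] _.
case: excluded_middle_informative => // -[]; split=> //.
  exact: (mon_dvd_trans autR nu0 p_nu nu_rho).
by move=> rho_p; apply: nu_p; exact: (mon_dvd_trans autR rho0 nu_rho rho_p).
Qed.

Lemma rank_lt i j rho : pos i = pos j -> rho.1 != 0 ->
  dvd (mu2 i j) rho -> ~ dvd rho (mu2 i j) -> (rank (mu2 i j) < rank rho)%N.
Proof.
move=> ij rho0 d nd; have ij0 := mu2_neq0 ij; apply: proper_card; apply/properP; split.
  apply/subsetP => p; rewrite !inE.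
  case: excluded_middle_informative => // -[pos_p p_nu nu_p] _.
  case: excluded_middle_informative => // -[]; split=> //.
    exact: (mon_dvd_trans autR ij0 p_nu d).
  by move=> rho_p; apply: nu_p; exact: (mon_dvd_trans autR rho0 d rho_p).
(* The pair [(i, j)] itself is counted for [rho] but not for [mu2 i j]. *)
exists (i, j); rewrite !inE; first by case: excluded_middle_informative => // -[].
by case: excluded_middle_informative => // -[_ _ []]; apply: mon_dvd_refl.
Qed.

Variable c3 : 'I_N -> 'I_N -> 'I_N -> R.
Hypothesis lcm3 : lcm3_choice O mu pos c2 c3.
Local Notation mu3 := (mu3 mu c3).

Lemma mu2_dvd_mu3 i j k : pos i = pos j -> pos j = pos k ->
  [/\ (mu3 i j k).1 != 0, dvd (mu2 i j) (mu3 i j k), dvd (mu2 i k) (mu3 i j k)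
    & dvd (mu2 j k) (mu3 i j k)].
Proof.
move=> ij jk; have ik := etrans ij jk.
have nu0 : (mu3 i j k).1 != 0.
  apply: is_lcm_neq0 (lcm3 ij jk) _ => a; rewrite !inE.
  by case/or3P => /eqP->; rewrite alpha_term_eq0 // mu2_neq0.
(* Unfolding the lcm in [tau3 <= tau3] yields the bounds for the three single terms, and from them
   those for every [tau2]. *)
have le_tau3 := lepm_refl (tau3 mu i j k).
rewrite {1}/tau3 lem_mlcm {1}/tau2 lem_mlcm in le_tau3.
have /andP[/andP[le_i le_j] le_k] := le_tau3.
by split=> //; apply/mon_dvdP; rewrite ?mu2_neq0 //; split=> /=;
  rewrite ?lem_mlcm ?le_i ?le_j ?le_k //; apply: (lcm3 ij jk).1; rewrite !inE eqxx ?orbT.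
Qed.

Lemma useful_pairs_irredundant :
  useful_pairs O mu pos c2
    (fun i j => [/\ (i < j)%N, pos i = pos j & ~ redundant O mu pos c2 c3 i j]).
Proof.
apply: useful_pairsP => [i j []//|h lead_h].
apply: lspan_ker lead_h => // i j _; set B := fun v => _.
(* Lexicographic order on rank and larger index, encoded in base [N], which exceeds every index. *)
pose size2 i j := (rank (mu2 i j) * N + maxn i j)%N.
have [r] := ubnP (size2 i j); elim: r => // r IH in i j *; rewrite ltnS => le_r ij.
wlog lt_ij : i j ij le_r / (i < j)%N.
  move=> th; have [lt_ij|lt_ji|/val_inj->] := ltngtP i j; first exact: th.
    rewrite spairN //; apply: lspanN; apply: th => //.
    by rewrite /size2 -mu2C // maxnC.
  by rewrite spairii; apply: lspan0.
have small k l : pos k = pos l -> dvd (mu2 k l) (mu2 i j) ->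
    ~ dvd (mu2 i j) (mu2 k l) -> lspan B (b k l).
  move=> kl d nd; apply: IH => //; apply: leq_trans le_r.
  have lt_max : (maxn k l < N)%N by rewrite gtn_max !ltn_ord.
  have lt_rank := rank_lt kl (mu2_neq0 ij) d nd.
  rewrite /size2 (leq_trans _ (leq_addr _ _)) //.
  by rewrite (leq_trans _ (leq_mul lt_rank (leqnn N))) // mulSn addnC ltn_add2r.
case: (excluded_middle_informative (redundant O mu pos c2 c3 i j)); last first.
  by move=> irr; apply: mem_lspan; exists i, j.
case=> [[k [_ ki kj as3 [nik nij]]]|[k [lt_kj ki kj dvd_jk nij]]].
  (* Criterion (a): both replacing S-pairs have strictly smaller monomials. *)
  have [ik jk] := (esym ki, esym kj).
  have [nu0 _ ik3 jk3] := mu2_dvd_mu3 ij jk; have d3 := mon_assoc_dvd O as3.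
  have dik := mon_dvd_trans autR nu0 ik3 d3.
  have djk := mon_dvd_trans autR nu0 jk3 d3.
  have ndik : ~ dvd (mu2 i j) (mu2 i k).
    by move=> ijk; apply: nik; apply: mon_dvd_anti dik ijk; rewrite ?mu2_neq0.
  have ndjk : ~ dvd (mu2 i j) (mu2 j k).
    by move=> ijk; apply: nij; apply: mon_dvd_anti ijk djk; rewrite ?mu2_neq0.
  rewrite (mu2C jk) in djk ndjk; rewrite (spair_trans ij kj dik djk).
  by apply: lspanD; apply: lspanZ; apply: small.
(* Criterion (b): [mu2 j k] is strictly smaller, while [mu2 i k] may be associate to [mu2 i j];
   there the larger index drops, as [i] and [k] are both below [j]. *)
have [ik jk] := (esym ki, esym kj).
have ndjk : ~ dvd (mu2 i j) (mu2 j k).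
  by move=> ijk; apply: nij; apply: mon_dvd_anti ijk dvd_jk; rewrite ?mu2_neq0.
have dik : dvd (mu2 i k) (mu2 i j).
  apply: mu2_min => //; [exact: mu2_neq0 | exact: mu_dvd_mu2l |].
  by apply: (mon_dvd_trans autR (mu2_neq0 jk)) dvd_jk; apply: mu_dvd_mu2r.
rewrite (mu2C jk) in dvd_jk ndjk; rewrite (spair_trans ij kj dik dvd_jk).
apply: lspanD; apply: lspanZ; last exact: small.
apply: IH => //; apply: leq_trans le_r; rewrite /size2 -addnS leq_add //.
  by rewrite leq_mul2r rank_le ?orbT // mu2_neq0.
by rewrite gtn_max (maxn_idPr (ltnW lt_ij)) lt_ij.
Qed.

End Family.


(** * Passing from a family to one with an additional last element *)

Section Extension.

Variables (R : idomainType) (n m : nat) (O : mvOre R n) (N : nat).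
Let widen : 'I_N -> 'I_N.+1 := widen_ord (leqnSn N).

Definition row_widen (v : 'rV[graded O]_N) : 'rV[graded O]_N.+1 :=
  \sum_i v 0 i *: delta_mx 0 (widen i).

Lemma row_widen_is_linear : linear row_widen.
Proof.
move=> a v w; rewrite /row_widen scaler_sumr -big_split; apply: eq_bigr => i _.
by rewrite !mxE /= scalerDl !scalerA.
Qed.

HB.instance Definition _ :=
  GRing.isLinear.Build (graded O) 'rV[graded O]_N 'rV[graded O]_N.+1 _ row_widen
    row_widen_is_linear.

Lemma row_widen_delta i : row_widen (delta_mx 0 i) = delta_mx 0 (widen i).
Proof.
rewrite /row_widen (bigD1 i) //= big1 ?addr0 => [|j /negPf ji]; last first.
  by rewrite mxE ji scale0r.
by rewrite mxE !eqxx scale1r.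
Qed.

Variables (mu : 'I_N -> R * 'X_{1..n}) (pos : 'I_N -> 'I_m) (c2 : 'I_N -> 'I_N -> R).
Variables (mu' : 'I_N.+1 -> R * 'X_{1..n}) (pos' : 'I_N.+1 -> 'I_m).
Variable c2' : 'I_N.+1 -> 'I_N.+1 -> R.
Hypothesis mu'E : forall i, mu' (widen i) = mu i.
Hypothesis pos'E : forall i, pos' (widen i) = pos i.
Hypothesis c2'E : forall i j, c2' (widen i) (widen j) = c2 i j.

Lemma row_widen_spair i j :
  row_widen (spair O mu c2 i j) = spair O mu' c2' (widen i) (widen j).
Proof.
have lin p q (v w : 'rV[graded O]_N) :
    row_widen (p *: v - q *: w) = p *: row_widen v - q *: row_widen w.
  by rewrite linearB !linearZ.
rewrite /spair lin !row_widen_delta /mu2 /tau2 !mu'E c2'E; reflexivity.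
Qed.

(** A syzygy vanishing at the last position is the image of a syzygy of the first [N] elements,
    where generators are already known. *)
Lemma lspan_ker_widen (B : 'rV[graded O]_N -> Prop) (B' : 'rV[graded O]_N.+1 -> Prop) h :
  (forall v, B v -> B' (row_widen v)) ->
  generates B (fun v => lead_map mu pos v = 0) ->
  lead_map mu' pos' h = 0 -> h 0 ord_max = 0 -> lspan B' h.
Proof.
move=> BB' [_ B_ker] lead_h h_max.
have -> : h = row_widen (\row_i h 0 (widen i)).
  rewrite [LHS]row_sum_delta big_ord_recr /= h_max scale0r addr0.
  by apply: eq_bigr => i _; rewrite mxE.
apply: lspan_map BB' _; apply: B_ker; rewrite -[RHS]lead_h /lead_map.
rewrite big_ord_recr /= h_max scale0r addr0.
by apply: eq_bigr => i _; rewrite mxE mu'E pos'E.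
Qed.

End Extension.

(** * Assembly of the three statements *)

Theorem lemma63 (R : idomainType) (zachR : left_zacharias R)
  (pidR : principal_ideal_domain R)
  (n m u : nat) (O : mvOre R n)
  (autR : forall i : 'I_n, bijective (ore_alphaR O i))
  (leT : rel 'X_{1..n}) (leTm : rel ('X_{1..n} * 'I_m))
  (ordT : term_order leT) (ordTm : module_term_order leT leTm)
  (g : 'I_u -> 'rV[O]_m) (g_neq0 : forall i, g i != 0)
  (mu : 'I_u -> R * 'X_{1..n}) (pos : 'I_u -> 'I_m)
  (maxg : forall i, is_max_monomial leTm (g i) (mu i) (pos i))
  (c2 : 'I_u -> 'I_u -> R) (c3 : 'I_u -> 'I_u -> 'I_u -> R)
  (lcm2 : lcm2_choice O mu pos c2) (lcm3 : lcm3_choice O mu pos c2 c3) :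
  let mu2 := mu2 mu c2 in
  let mu3 := mu3 mu c3 in
  let b := spair O mu c2 in
  (forall i j k : 'I_u, pos i = pos j -> pos j = pos k ->
     mon_quo O (mu3 i j k) (mu2 i k) *: b i k
     - mon_quo O (mu3 i j k) (mu2 i j) *: b i j
     + mon_quo O (mu3 i j k) (mu2 k j) *: b k j = 0)
  /\
  useful_pairs O mu pos c2
    (fun i j => [/\ (i < j)%N, pos i = pos j & ~ redundant O mu pos c2 c3 i j])
  /\
  (forall (s : 'I_u) (GM : 'I_u -> 'I_u -> Prop)
     (choice : R * 'X_{1..n} -> 'I_u),
     useful_pairs_upto O (ltnW (ltn_ord s)) mu pos c2 GM ->
     (forall nu, Mbar mu pos c2 s nu -> ~ Mbar' O mu pos c2 s nu ->
        [/\ (choice nu < s)%N, pos (choice nu) = pos s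
          & mon_assoc nu (mu2 (choice nu) s)]) ->
     useful_pairs_upto O (ltn_ord s) mu pos c2
       (fun i j => GM i j \/
          exists nu, [/\ Mbar mu pos c2 s nu, ~ Mbar' O mu pos c2 s nu,
                         i = choice nu & j = s])).

Proof.
move=> /=; have mu0 i : (mu i).1 != 0 by have [p []] := maxg i.
split=> [i j k ij jk|].
  have [_ dij dik djk] := mu2_dvd_mu3 autR mu0 lcm2 lcm3 ij jk.
  by apply: (spair_cocycle autR mu0 lcm2) => //; rewrite (mu2C lcm2 (esym jk)).
split; first exact: useful_pairs_irredundant.
move=> s GM choice [GM_s [GM_lt [GM_gen _]]] choiceP.
set GM' := fun i j : 'I_u => _.
pose w := widen_ord (ltn_ord s); have wS : w ord_max = s by apply: val_inj.
have wE (i : 'I_u) : (i < s)%N -> exists i' : 'I_s, i = w (widen_ord (leqnSn s) i').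
  by move=> lt_is; exists (Ordinal lt_is); apply: val_inj.
(* The two embeddings of ['I_s] carry different bound proofs, so the families of sizes [s] and
   [s.+1] are matched by this equation. *)
have ww (i : 'I_s) : w (widen_ord (leqnSn s) i) = widen_ord (ltnW (ltn_ord s)) i.
  exact: val_inj.
have GM'_lt i j : GM' i j -> [/\ (i < j)%N, (j <= s)%N & pos i = pos j].
  case=> [GMij|[nu [nuM nuM' -> ->]]]; last by have [] := choiceP nu nuM nuM'.
  have [lt_is lt_js] := GM_s i j GMij.
  have [[i' iE] [j' jE]] := (wE _ lt_is, wE _ lt_js).
  have := GM_lt i' j'; rewrite -!ww -iE -jE => /(_ GMij)[lt_ij ->].
  by split; rewrite ?(ltnW lt_js) // iE jE.
split=> [i j /GM'_lt[lt_ij le_js _]|].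
  by rewrite !ltnS le_js (leq_trans (ltnW lt_ij)).
have lcm2w : lcm2_choice O (fun i => mu (w i)) (fun i => pos (w i)) (fun i j => c2 (w i) (w j)).
  by move=> i j; apply: lcm2.
apply: useful_pairsP => // [i j /GM'_lt[]//|].
(* A member of [Mbar'] has a strict divisor in [Mbar]; the descent ends because [rank] decreases. *)
have minimal nu : Mbar mu pos c2 s nu ->
    exists nu', [/\ Mbar mu pos c2 s nu', ~ Mbar' O mu pos c2 s nu' & mon_dvd O nu' nu].
  have [r] := ubnP (rank O mu pos c2 nu); elim: r => // r IH in nu *.
  rewrite ltnS => le_r nuM.
  case: (excluded_middle_informative (Mbar' O mu pos c2 s nu)) => [|nuM']; last first.
    by exists nu; split=> //; apply: mon_dvd_refl.
  case=> _ [nu' [nu'M dvd_nu nassoc]].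
  have [[j [_ pos_j nuE]] [k [_ pos_k nu'E]]] := (nuM, nu'M).
  have nu0 : nu.1 != 0 by rewrite nuE; apply: (mu2_neq0 autR mu0 lcm2).
  have nu'0 : nu'.1 != 0 by rewrite nu'E; apply: (mu2_neq0 autR mu0 lcm2).
  have [|nu'' [nu''M nu''M' dvd_nu']] := IH nu' _ nu'M; last first.
    by exists nu''; split=> //; apply: (mon_dvd_trans autR nu'0).
  apply: leq_trans le_r; rewrite nu'E; apply: (rank_lt autR mu0 lcm2) => //.
    by rewrite -nu'E.
  by rewrite -nu'E => nu_nu'; apply: nassoc; apply: mon_dvd_anti nu_nu' dvd_nu.
apply: (lspan_ker_step autR _ lcm2w pidR (s := ord_max)) => //.
- by move=> i; rewrite -ltnS.
- move=> h; apply: (lspan_ker_widen (fun i => congr1 mu (ww i))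
    (fun i => congr1 pos (ww i)) _ GM_gen) => _ [i [j [GMij ->]]].
  exists (widen_ord (leqnSn s) i), (widen_ord (leqnSn s) j); split.
    by rewrite -/w !ww; left.
  by apply: row_widen_spair => [k|k l]; rewrite -/w !ww.
move=> i lt_is pos_i; rewrite /= in lt_is.
(* The S-pair that replaces [b i s] is the one chosen for a minimal divisor [nu] of [mu2 i s]; its
   monomial agrees with [nu] up to a unit. *)
have [|nu [nuM nuM' dvd_nu]] := minimal (mu2 mu c2 (w i) s).
  by exists (w i); split=> //; rewrite pos_i wS.
have [lt_cs pos_c nu_assoc] := choiceP nu nuM nuM'.
have [j jE] := wE _ lt_cs; exists (widen_ord (leqnSn s) j); split=> //.
- exact: (ltn_ord j).
- by rewrite -jE wS.
- exists (widen_ord (leqnSn s) j), ord_max; split=> //; right; exists nu.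
  by rewrite -/w -jE wS.
change (mon_dvd O (mu2 mu c2 (w (widen_ord (leqnSn s) j)) (w ord_max))
  (mu2 mu c2 (w i) (w ord_max))).
have nu0 : nu.1 != 0.
  by have [k [_ pos_k ->]] := nuM; apply: (mu2_neq0 autR mu0 lcm2).
rewrite wS -jE; apply: (mon_dvd_trans autR nu0) dvd_nu.
by apply: mon_assoc_dvd; apply: mon_assoc_sym.
Qed.
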